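(* Let $\epsilon>0$ be a privacy parameter and let $\rho:\mathcal{X}\times\mathcal{Z}\to\mathbb{R}$ be a rating function with sensitivity $\Delta$, where $|\mathcal{Z}|=L$. Let $$\bar\Delta:=\max_{x\in\mathcal{X}}\max_{z,z'\in\mathcal{Z}}|\rho(x,z)-\rho(x,z')|.$$ Then the privacy loss $\ell(\mathcal{E}_{\epsilon,\rho})$ of the Exponential mechanism $\mathcal{E}_{\epsilon,\rho}$ is bounded by $\bar\epsilon+\ln\eta$, where $$\bar\epsilon:=\epsilon\frac{\bar\Delta}{\Delta}\qquad\text{and}\qquad \eta=\eta(\bar\epsilon,L)=\frac{e^{-\bar\epsilon/2}+L-1}{e^{\bar\epsilon/2}+L-1}<1.$$
   Context: **Adjacency and sensitivity.** $\mathcal{X}$ carries a metric $d_{\mathcal{X}}$; inputs $x_1,x_2\in\mathcal{X}$ are adjacent, written $x_1\sim x_2$, if $d_{\mathcal{X}}(x_1,x_2)\le1$. A rating function from $\mathcal{X}$ to $\mathcal{Z}$ is a function $\rho:\mathcal{X}\times\mathcal{Z}\to\mathbb{R}$, and its sensitivity is $\Delta=\max_{z\in\mathcal{Z}}\max_{x_1\sim x_2}\big(\rho(x_1,z)-\rho(x_2,z)\big)$. **Exponential mechanism (discrete version).** For $x\in\mathcal{X}$, $\mathcal{E}_{\epsilon,\rho}(x)$ is the $\mathcal{Z}$-valued random variable with $$\Pr[\mathcal{E}_{\epsilon,\rho}(x)=z]=\frac{\exp\left(\frac{\epsilon}{2\Delta}\rho(x,z)\right)}{\sum_{z'\in\mathcal{Z}}\exp\left(\frac{\epsilon}{2\Delta}\rho(x,z')\right)}.$$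 **Privacy loss.** A randomized mechanism $\mathcal{M}$ from $\mathcal{X}$ to $\mathcal{Z}$ assigns to each $x\in\mathcal{X}$ a random variable $\mathcal{M}(x)$ on $\mathcal{Z}$. Writing $\mathrm{Im}(\mathcal{M})$ for its set of possible outputs, its privacy loss is $$\ell(\mathcal{M})=\sup_{x_1\sim x_2}\ \sup_{Z\subseteq\mathrm{Im}(\mathcal{M})}\ln\frac{\Pr[\mathcal{M}(x_1)\in Z]}{\Pr[\mathcal{M}(x_2)\in Z]}.$$
   Formalization: The claim η < 1 is made only when Δ̄ > 0, because Δ̄ = 0 (for example L = 1) gives η = 1; the sensitivity Δ is assumed positive so that the mechanism and ε̄ are defined. *)

(* Defs.v *)
From HB Require Import structures.
From mathcomp Require Import all_boot all_order all_algebra.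
From mathcomp Require Import all_classical all_reals all_analysis.

Set Implicit Arguments.
Unset Strict Implicit.
Unset Printing Implicit Defensive.
Import Order.TTheory GRing.Theory Num.Theory.

Local Open Scope classical_set_scope.
Local Open Scope ring_scope.

Definition is_max (R : realType) (A : set R) (m : R) : Prop :=
  A m /\ ubound A m.

Definition adjacent (R : realType) (X : metricType R) (x1 x2 : X) : Prop :=
  mdist x1 x2 <= 1.

Definition is_sensitivity (R : realType) (X : metricType R) (Z : Type)
    (rho : X -> Z -> R) (Delta : R) : Prop :=
  is_max [set r | exists z x1 x2,
           adjacent x1 x2 /\ r = rho x1 z - rho x2 z] Delta.

(* The quantity written "Delta bar". *)
Definition is_max_spread (R : realType) (X Z : Type)
    (rho : X -> Z -> R) (Dbar : R) : Prop :=
  is_max [set r | exists x z z', r = `|rho x z - rho x z'|] Dbar.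

(* A mechanism is represented by the laws of its output random variables:
   [M x A] is Pr[M(x) \in A]. *)
Definition mechanism (R : realType) (X : Type) (d : measure_display)
    (Z : measurableType d) : Type :=
  X -> probability Z R.

(* The possible outputs of a mechanism with countably many outputs. *)
Definition Im (R : realType) (X : Type) (d : measure_display)
    (Z : measurableType d) (M : mechanism R X Z) : set Z :=
  [set z | exists x, (0 < M x [set z])%E].

(* In [\bar R] one has 0^-1 = +oo, 0 * +oo = 0 and lne 0 = -oo.  The log-ratio
   is therefore +oo when only the denominator vanishes, and -oo when the
   numerator does; in particular the indeterminate form 0 / 0 (for instance
   for the empty event) does not contribute to the supremum. *)
Definition privacy_loss (R : realType) (X : metricType R)
    (d : measure_display) (Z : measurableType d) (M : mechanism R X Z) :
    \bar R :=
  ereal_sup [set l | exists x1 x2 (A : set Z),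
    [/\ adjacent x1 x2, measurable A, A `<=` Im M &
        l = lne (M x1 A / M x2 A)%E]].

(* On a finite discrete space this determines every law [M x]. *)
Definition is_exponential_mechanism (R : realType) (X : Type)
    (d : measure_display) (Z : measurableType d) (eps Delta : R)
    (rho : X -> Z -> R) (M : mechanism R X Z) : Prop :=
  forall x z, M x [set z] =
    (expR (eps / (2 * Delta) * rho x z) /
     \sum_(z' \in [set: Z]) expR (eps / (2 * Delta) * rho x z'))%:E.

Definition ebar (R : realType) (eps Delta Dbar : R) : R := eps * (Dbar / Delta).

Definition eta (R : realType) (e : R) (L : nat) : R :=
  (expR (- e / 2) + L%:R - 1) / (expR (e / 2) + L%:R - 1).

(* Main.v *)
(** Put [a = e^{ebar/2}].  For a fixed input all
    weights [exp (eps / (2 Delta) * rho x z)] lie within a factor [a] of each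
    other, so an atom has mass at most [a / (a + L - 1)], attained when all the
    other weights are [a] times smaller, and at least [1 / (1 + a (L - 1))],
    attained when they are [a] times larger.  The quotient of these two bounds
    is [a^2 eta], and a bound on the likelihood ratio of every atom passes to
    all events by additivity. *)
Require Import Defs.
From mathcomp Require Import all_boot all_order all_algebra.
From mathcomp Require Import all_classical all_reals all_analysis.
From mathcomp Require Import finmap ring lra.
Import Order.TTheory GRing.Theory Num.Theory.
Local Open Scope classical_set_scope.
Local Open Scope ring_scope.

(** Once [m] is subtracted from every term, all terms are nonnegative, so the sum is at least its
    single term at [z]. *)
Lemma fsumr_ge_point (R : realType) (T : choiceType) (D : set T) (n : nat)
    (f : T -> R) (z : T) (m : R) :
  (D #= `I_n)%card -> D z -> (forall t, D t -> m <= f t) ->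
  f z + (n%:R - 1) * m <= \sum_(t \in D) f t.
Proof.
move=> cD Dz mf; have fD : finite_set D by exists n.
have memD t : t \in fset_set D -> D t by rewrite in_fset_set// => /set_mem.
have zD : z \in fset_set D by rewrite in_fset_set//; exact/mem_set.
rewrite fsbig_finite//.
have sumD : \sum_(t <- fset_set D) (f t - m)
    = \sum_(t <- fset_set D) f t - n%:R * m.
  rewrite sumrB big_const_seq count_predT iter_addr_0 mulr_natl.
  by rewrite (card_fset_set cD).
have : f z - m <= \sum_(t <- fset_set D) (f t - m).
  rewrite (bigD1_seq z)//= lerDl big_seq_cond sumr_ge0// => t /andP[tD _].
  by rewrite subr_ge0 mf//; exact: memD.
by rewrite sumD; lra.
Qed.

Lemma fsumr_le_point (R : realType) (T : choiceType) (D : set T) (n : nat)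
    (f : T -> R) (z : T) (m : R) :
  (D #= `I_n)%card -> D z -> (forall t, D t -> f t <= m) ->
  \sum_(t \in D) f t <= f z + (n%:R - 1) * m.
Proof.
move=> cD Dz fm; have fD : finite_set D by exists n.
have := @fsumr_ge_point R T D n (fun t => - f t) z (- m) cD Dz.
rewrite !fsbig_finite// sumrN => /(_ _)H.
have {H}: - f z + (n%:R - 1) * - m <= - \sum_(t <- fset_set D) f t.
  by apply: H => t /fm; rewrite lerN2.
by lra.
Qed.

(** The two masses are bounded separately. In each total the weight at [z] is kept and the [n - 1]
    others are replaced by an extreme multiple of it, so that [w z] and [v z] cancel. *)
Lemma normalized_weight_ratio (R : realType) (T : choiceType) (n : nat)
    (w v : T -> R) (a : R) (z : T) :
  ([set: T] #= `I_n)%card -> 0 < a -> (0 < n)%N ->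
  (forall t, 0 < w t) -> (forall t, 0 < v t) ->
  (forall t t', w t <= a * w t') -> (forall t t', v t <= a * v t') ->
  w z / \sum_(t \in [set: T]) w t <=
  a * (1 + a * (n%:R - 1)) / (a + n%:R - 1) *
    (v z / \sum_(t \in [set: T]) v t).
Proof.
move=> cT a0 n_gt0 w0 v0 wa va.
have Sw : w z + (n%:R - 1) * (a^-1 * w z) <= \sum_(t \in [set: T]) w t.
  by apply: fsumr_ge_point => // t _; rewrite ler_pdivrMl.
have Sv : \sum_(t \in [set: T]) v t <= v z + (n%:R - 1) * (a * v z).
  exact: fsumr_le_point.
(* This lower bound serves to make the total weight of [v] positive. *)
have Sv' : v z + (n%:R - 1) * (a^-1 * v z) <= \sum_(t \in [set: T]) v t.
  by apply: fsumr_ge_point => // t _; rewrite ler_pdivrMl.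
move: (\sum_(t \in _) w t) (\sum_(t \in _) v t) Sw Sv Sv' => S S' Sw Sv Sv'.
have n0 : 0 <= n%:R - 1 :> R by rewrite subr_ge0 ler1n.
have wz := w0 z; have vz := v0 z.
have ai : 0 < a^-1 by rewrite invr_gt0.
have S0 : 0 < S.
  by apply: lt_le_trans Sw; rewrite ltr_wpDr// mulr_ge0// ltW// mulr_gt0.
have S'0 : 0 < S'.
  by apply: lt_le_trans Sv'; rewrite ltr_wpDr// mulr_ge0// ltW// mulr_gt0.
have d0 : 0 < a + n%:R - 1 by lra.
have e0 : 0 < 1 + a * (n%:R - 1).
  by rewrite ltr_pwDl// mulr_ge0// ltW.
have upper : w z / S <= a / (a + n%:R - 1).
  rewrite ler_pdivrMr// mulrAC ler_pdivlMr//.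
  (* Multiplied by [a], the left side of [Sw] becomes exactly [w z * (a + n%:R - 1)]. *)
  apply: le_trans (ler_wpM2l (ltW a0) Sw); rewrite le_eqVlt; apply/orP; left.
  by apply/eqP; field; rewrite gt_eqF.
have lower : (1 + a * (n%:R - 1))^-1 <= v z / S'.
  rewrite ler_pdivlMr// ler_pdivrMl//; apply: le_trans Sv _.
  by rewrite le_eqVlt; apply/orP; left; apply/eqP; ring.
apply: (le_trans upper).
rewrite [X in _ <= X * _]mulrAC -(mulrA (a / _)) -[leLHS]mulr1.
rewrite ler_pM2l ?divr_gt0//.
by rewrite -ler_pdivrMl// mulr1.
Qed.

Lemma measure_le_atoms (R : realType) (d : measure_display)
    (T : measurableType d) (P Q : {measure set T -> \bar R}) (k : \bar R)
    (A : set T) :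
  finite_set A -> (forall t, A t -> measurable [set t]) ->
  (forall t, A t -> P [set t] <= k * Q [set t])%E -> (P A <= k * Q A)%E.
Proof.
move=> fA mA PQ.
have tA : trivIset A (fun t : T => [set t]).
  by move=> s t _ _ [x [/= -> ->]].
rewrite -(fsbig_setU_set1 fA) !measure_fsbig//.
rewrite ge0_mule_fsumr//; exact: lee_fsum.
Qed.

Lemma lne_ratio_le (R : realType) (p q : \bar R) (k : R) :
  0 < k -> (0 <= p)%E -> (0 <= q < +oo)%E -> (p <= k%:E * q)%E ->
  (lne (p / q) <= (ln k)%:E)%E.
Proof.
move=> k0 p0 /andP[]; case: q => [q| |]//; rewrite lee_fin => q0 _ pq.
(* If [q = 0] then [p = 0] as well, and the conventions give the quotient [0] with logarithm [-oo].
   Otherwise both masses are real and [ln] is monotone. *)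
move: pq; have [->|qN0] := eqVneq q 0.
  rewrite mule0 => p_le0; have -> : p = 0%E by apply/le_anti; rewrite p_le0.
  by rewrite mul0e le0_lneNy ?leNye.
have qgt0 : 0 < q by rewrite lt_neqAle eq_sym qN0.
move: p0; case: p => [p| |]//; rewrite -EFinM !lee_fin => p0 pq.
rewrite inver (negbTE qN0) -EFinM -(lne_EFin k0) lee_lne.
- by rewrite lee_fin ler_pdivrMr.
- by rewrite in_itv/= leey andbT lee_fin divr_ge0.
- by rewrite in_itv/= leey andbT lee_fin ltW.
Qed.

Theorem theorem3p4 (R : realType) (X : metricType R)
    (d : measure_display) (Z : measurableType d)
    (eps Delta Dbar : R) (L : nat) (rho : X -> Z -> R) (E : mechanism R X Z)
    (hdiscrete : forall A : set Z, measurable A)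
    (hL : ([set: Z] #= `I_L)%card)
    (heps : 0 < eps)
    (hDelta : is_sensitivity rho Delta) (hDelta0 : 0 < Delta)
    (hDbar : is_max_spread rho Dbar)
    (hE : is_exponential_mechanism eps Delta rho E) :
  (privacy_loss E <=
     (ebar eps Delta Dbar + ln (eta (ebar eps Delta Dbar) L))%:E)%E
  /\ (0 < Dbar -> eta (ebar eps Delta Dbar) L < 1).
Proof.
(* The maximal spread is attained, so [Z] has a point [z0] and [L] is positive. *)
have [[_ [z0 _]] Dmax] := hDbar.
have L_gt0 : (0 < L)%N.
  rewrite lt0n; apply/eqP => L0.
  by move: hL; rewrite L0 II0 card_eq0 => /eqP/seteqP[/(_ z0)/(_ I)].
have L1 : 0 <= L%:R - 1 :> R by rewrite subr_ge0 ler1n.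
set e := ebar _ _ _; set a := expR (e / 2).
have a0 : 0 < a by exact: expR_gt0.
have etaE : eta e L = (a^-1 + L%:R - 1) / (a + L%:R - 1).
  by rewrite /eta mulNr expRN.
have d0 : 0 < a + L%:R - 1 by lra.
have ai0 : 0 < a^-1 by rewrite invr_gt0.
have eta0 : 0 < eta e L by rewrite etaE divr_gt0//; lra.
split; last first.
  (* A positive spread gives [a^-1 < 1 < a]; for [Dbar = 0] one would have [a = 1] and [eta] equal
     to 1. *)
  move=> D0; rewrite etaE ltr_pdivrMr// mul1r ltrD2r ltrD2r.
  have a1 : 1 < a by rewrite expR_gt1 divr_gt0// mulr_gt0 ?divr_gt0.
  by rewrite (lt_trans _ a1)// invf_lt1.
have KE : e + ln (eta e L) = ln (a ^+ 2 * eta e L).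
  rewrite lnM ?posrE ?exprn_gt0// -expRM_natl expRK.
  by congr (_ + _); field.
have c0 : 0 < eps / (2 * Delta) by rewrite divr_gt0 ?mulr_gt0.
pose w x z := expR (eps / (2 * Delta) * rho x z).
have wa x z z' : w x z <= a * w x z'.
  rewrite /w /a -expRD ler_expR -lerBlDr -mulrBr.
  (* The largest gap between two exponents for one input is [eps / (2 * Delta) * Dbar], which is why
     [a] is built from [e / 2]. *)
  have -> : e / 2 = eps / (2 * Delta) * Dbar.
    by rewrite /e /ebar; field; rewrite gt_eqF.
  rewrite ler_pM2l// (le_trans (ler_norm _))//.
  by apply: Dmax; exists x, z, z'.
rewrite KE; apply: ge_ereal_sup => _ [x1 [x2 [A [_ mA _ ->]]]].
apply: lne_ratio_le.
- by rewrite mulr_gt0 ?exprn_gt0.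
- exact: measure_ge0.
- by apply/andP; split; [exact: measure_ge0|
    rewrite (le_lt_trans (probability_le1 _ mA))// ltry].
apply: measure_le_atoms => //.
  by apply: (@sub_finite_set _ _ setT) => //; exists L.
move=> z _; change (E x1 [set z] <= (a ^+ 2 * eta e L)%:E * E x2 [set z])%E.
rewrite !hE -EFinM lee_fin.
(* One factor [a] is absorbed by [a * (a^-1 + L%:R - 1) = 1 + a * (L%:R - 1)]. *)
have -> : a ^+ 2 * eta e L = a * (1 + a * (L%:R - 1)) / (a + L%:R - 1).
  by rewrite etaE; field; rewrite !gt_eqF.
apply: (@normalized_weight_ratio R Z L (w x1) (w x2) a z) => // t;
  exact: expR_gt0.
Qed.
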